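(* Let $\Phi = [\varphi_1,\dots,\varphi_m] \in \mathbb{C}^{n\times m}$ have full column rank, let $y \in \mathbb{C}^n$ be arbitrary, and let $1 \le k \le m$. Let $x_k \in \mathbb{C}^m$, $x_k \ne 0$, be a solution of the subset selection problem with sparsity $k$, \[ \min_{A \subseteq \{1,\dots,m\},\ |A| = k}\ \min_{x}\ \Big\| y - \sum_{i\in A} x_i \varphi_i \Big\|_2 , \] i.e. $x_k$ has at most $k$ non-zero entries and minimizes $\|y - \Phi x\|_2$ among all $x\in\mathbb{C}^m$ with at most $k$ non-zero entries. Let $S = \{ i : (x_k)_i \ne 0\}$ be its support and $r_k = y - \Phi x_k$ the associated residual. If \[ \frac{\sigma_{\min}(\Phi)}{2}\, \min_{i\in S} |(x_k)_i| \;>\; \|r_k\|_2 , \] where $\sigma_{\min}(\Phi)$ is the smallest singular value of $\Phi$, then both Backward Regression and LACE (Least-Absolute Coefficient Elimination), run with matrix $\Phi$, target $y$ and desired sparsity $k$, recover $x_k$; that is, for each of the two algorithms, if $A$ is the returned index set, then the vector in $\mathbb{C}^m$ that equals the least-squares coefficients $\Phi_A^+ y$ on $A$ and zero outside $A$ is $x_k$.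
   Context: For an index set $A \subseteq \{1,\dots,m\}$, $\Phi_A$ is the submatrix of $\Phi$ consisting of the columns $\varphi_i$ with $i\in A$, and $\Phi_A^+$ is its Moore–Penrose pseudoinverse. The least-squares residual associated with $A$ and target $y\in\mathbb{C}^n$ is $r_A = (I - \Phi_A\Phi_A^+)y$ (so $r_\emptyset = y$), and the least-squares coefficient vector for $A$ is $x^{(A)} = \Phi_A^+ y$, with entries $x^{(A)}_i$ indexed by $i \in A$. Backward Regression with input $(\Phi, y, k)$: start with the active set $A = \{1,\dots,m\}$. While $|A| > k$, choose $i^* \in \arg\min_{i\in A} \| r_{A\setminus\{i\}}\|_2$ (ties broken arbitrarily) and replace $A$ by $A \setminus\{i^*\}$. Return $A$. LACE (Least-Absolute Coefficient Elimination) with input $(\Phi, y, k)$: the same procedure, except that the deleted index is chosen as $i^* \in \arg\min_{i \in A} |x^{(A)}_i|$ (ties broken arbitrarily). *)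

(* Defs.v *)
From mathcomp Require Import all_boot all_order all_algebra.
From mathcomp Require Import complex.
From mathcomp Require Import boolp classical_sets reals.

Set Implicit Arguments.
Unset Strict Implicit.
Unset Printing Implicit Defensive.

Import Order.TTheory GRing.Theory Num.Theory.

Local Open Scope ring_scope.
Local Open Scope complex_scope.
Local Open Scope sesquilinear_scope.

Definition norm2 (R : realType) (n : nat) (v : 'cV[R[i]]_n) : R :=
  Num.sqrt (\sum_(i < n) Normc.normc (v i 0) ^+ 2).

Definition supp (R : realType) (m : nat) (x : 'cV[R[i]]_m) : {set 'I_m} :=
  [set i | x i 0 != 0]%SET.

Definition is_pinv (R : realType) (n m : nat)
    (M : 'M[R[i]]_(n, m)) (X : 'M[R[i]]_(m, n)) : Prop :=
  [/\ M *m X *m M = M, X *m M *m X = X,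
      (M *m X)^t* = M *m X & (X *m M)^t* = X *m M].

(* The Moore-Penrose pseudoinverse; pinvP and is_pinv_unique below show that
   the Penrose equations have exactly one solution, so 0 is never used. *)
Definition pinv (R : realType) (n m : nat) (M : 'M[R[i]]_(n, m)) :
    'M[R[i]]_(m, n) :=
  xget 0 [set X | is_pinv M X]%classic.

(* spectral_diag lists the eigenvalues of the (hermitian) matrix M^t* *m M with
   multiplicity. All m of them are sorted in decreasing order, and the first
   min(n, m) square roots are the singular values: for n < m the remaining
   ones are zeros that do not count as singular values. *)
Definition singular_values (R : realType) (n m : nat)
    (M : 'M[R[i]]_(n, m)) : seq R :=
  take (minn n m)
    (sort (fun a b : R => b <= a)
       [seq Num.sqrt (complex.Re (spectral_diag (M^t* *m M) 0 i))
          | i <- enum 'I_m]).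

Definition sigma_min (R : realType) (n m : nat) (M : 'M[R[i]]_(n, m)) : R :=
  last 0 (singular_values M).

(* The infimum is a minimum whenever x != 0, its index set being finite. *)
Definition min_abs_supp (R : realType) (m : nat) (x : 'cV[R[i]]_m) : R :=
  inf [set Normc.normc (x i 0) | i in [set` supp x]]%classic.

Definition subset_selection_solution (R : realType) (n m : nat)
    (Phi : 'M[R[i]]_(n, m)) (y : 'cV[R[i]]_n) (k : nat) (x : 'cV[R[i]]_m) :
    Prop :=
  (#|supp x| <= k)%N /\
  forall z : 'cV[R[i]]_m, (#|supp z| <= k)%N ->
    norm2 (y - Phi *m x) <= norm2 (y - Phi *m z).

Definition subcols (R : realType) (n m : nat) (Phi : 'M[R[i]]_(n, m))
    (A : {set 'I_m}) : 'M[R[i]]_(n, #|A|) :=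
  colsub (fun j : 'I_#|A| => enum_val j) Phi.

Definition ls_residual (R : realType) (n m : nat) (Phi : 'M[R[i]]_(n, m))
    (y : 'cV[R[i]]_n) (A : {set 'I_m}) : 'cV[R[i]]_n :=
  (1%:M - subcols Phi A *m pinv (subcols Phi A)) *m y.

(* The entries of pinv (subcols Phi A) *m y are numbered by 'I_#|A|; ls_coef
   moves the j-th one to position enum_val j and is 0 outside A. *)
Definition ls_coef (R : realType) (n m : nat) (Phi : 'M[R[i]]_(n, m))
    (y : 'cV[R[i]]_n) (A : {set 'I_m}) : 'cV[R[i]]_m :=
  \col_i (if [pick j : 'I_#|A| | enum_val j == i] is Some j
          then (pinv (subcols Phi A) *m y) j 0 else 0).

(* elimination cost k A B: started at A, the loop that deletes an index of
   least cost while more than k are active may return B. Being a relation, it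
   allows every way of breaking ties. *)
Inductive elimination (R : realType) (m : nat)
    (cost : {set 'I_m} -> 'I_m -> R) (k : nat) :
    {set 'I_m} -> {set 'I_m} -> Prop :=
| elimination_stop (A : {set 'I_m}) :
    (#|A| <= k)%N -> elimination cost k A A
| elimination_step (A B : {set 'I_m}) (i : 'I_m) :
    (k < #|A|)%N -> i \in A ->
    (forall j : 'I_m, j \in A -> cost A i <= cost A j) ->
    elimination cost k (A :\ i)%SET B -> elimination cost k A B.

Definition backward_regression (R : realType) (n m : nat)
    (Phi : 'M[R[i]]_(n, m)) (y : 'cV[R[i]]_n) (k : nat) (A : {set 'I_m}) :
    Prop :=
  elimination (fun B i => norm2 (ls_residual Phi y (B :\ i)%SET)) k
    [set: 'I_m]%SET A.

Definition lace (R : realType) (n m : nat)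
    (Phi : 'M[R[i]]_(n, m)) (y : 'cV[R[i]]_n) (k : nat) (A : {set 'I_m}) :
    Prop :=
  elimination (fun B i => Normc.normc (ls_coef Phi y B i 0)) k [set: 'I_m]%SET A.

Lemma trmxC_mul (R : realType) (m n p : nat) (A : 'M[R[i]]_(m, n))
    (B : 'M[R[i]]_(n, p)) : (A *m B)^t* = B^t* *m A^t*.
Proof. by rewrite trmx_mul map_mxM. Qed.

Lemma gram_unit (R : realType) (r n : nat) (B : 'M[R[i]]_(r, n)) :
  row_free B -> B *m B^t* \in unitmx.
Proof.
move=> fB; rewrite -row_free_unit -kermx_eq0; apply/eqP/row_matrixP => j.
rewrite row0; set v := row j _.
have /(congr1 (fun w => w *m v^t*)) : v *m (B *m B^t*) = 0.
  by apply/sub_kermxP/row_sub.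
rewrite mul0mx !mulmxA -[_ *m B^t* *m _]mulmxA -trmxC_mul => vB0.
have : dotmx (v *m B) (v *m B) = 0 by rewrite dotmxE vB0 mxE.
move=> /eqP; rewrite dnorm_eq0 => /eqP vB.
by apply/(row_free_inj fB); rewrite mul0mx.
Qed.

Lemma is_pinv_exists (R : realType) (n m : nat) (M : 'M[R[i]]_(n, m)) :
  exists X, is_pinv M X.
Proof.
have fC : row_free ((col_base M)^t*).
  by rewrite /row_free mxrank_map mxrank_tr; apply: col_base_full.
rewrite -(mulmx_base M).
move: (col_base M) (row_base M) fC (row_base_free M).
move: (\rank M) => r C B /gram_unit; rewrite trmxCK => uC /gram_unit uB.
have hB : (invmx (B *m B^t*))^t* = invmx (B *m B^t*).
  by rewrite trmx_inv map_invmx trmxC_mul trmxCK.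
have hC : (invmx (C^t* *m C))^t* = invmx (C^t* *m C).
  by rewrite trmx_inv map_invmx trmxC_mul trmxCK.
pose X := B^t* *m invmx (B *m B^t*) *m (invmx (C^t* *m C) *m C^t*).
have MX : C *m B *m X = C *m (invmx (C^t* *m C) *m C^t*).
  rewrite /X -!mulmxA; congr (C *m _).
  by rewrite [B *m (B^t* *m _)]mulmxA mulKVmx.
have XM : X *m (C *m B) = B^t* *m invmx (B *m B^t*) *m B.
  rewrite /X -!mulmxA; congr (B^t* *m (_ *m _)).
  by rewrite [C^t* *m (C *m _)]mulmxA mulKmx.
exists X; split.
- rewrite MX -!mulmxA; congr (C *m _).
  by rewrite [C^t* *m (C *m _)]mulmxA mulKmx.
- rewrite XM /X -!mulmxA; congr (B^t* *m (_ *m _)).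
  by rewrite [B *m (B^t* *m _)]mulmxA mulKVmx.
- by rewrite MX !trmxC_mul trmxCK hC mulmxA.
- by rewrite XM !trmxC_mul trmxCK hB mulmxA.
Qed.

Lemma is_pinv_unique (R : realType) (n m : nat) (M : 'M[R[i]]_(n, m))
    (X Y : 'M[R[i]]_(m, n)) : is_pinv M X -> is_pinv M Y -> X = Y.
Proof.
move=> [a1 a2 a3 a4] [b1 b2 b3 b4].
have eMX : M *m X = M *m Y.
  rewrite -a3 -{1}b1 -(mulmxA (M *m Y)) trmxC_mul a3 b3.
  by rewrite mulmxA a1.
have eXM : X *m M = Y *m M.
  rewrite -a4 -{1}b1 -[M *m Y *m M]mulmxA mulmxA trmxC_mul a4 b4.
  by rewrite -mulmxA [M *m _]mulmxA a1.
by rewrite -a2 eXM -mulmxA eMX mulmxA b2.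
Qed.

Lemma pinvP (R : realType) (n m : nat) (M : 'M[R[i]]_(n, m)) :
  is_pinv M (pinv M).
Proof. by have [X XP] := is_pinv_exists M; apply: (xgetI 0 XP). Qed.

Lemma elimination_exists (R : realType) (m : nat)
    (cost : {set 'I_m} -> 'I_m -> R) (k : nat) (A : {set 'I_m}) :
  exists B, elimination cost k A B.
Proof.
have [N] := ubnP #|A|; elim: N A => // N IH A leAN.
have [leAk|ltkA] := leqP #|A| k; first by exists A; apply: elimination_stop.
have /card_gt0P[i0 Ai0] : (0 < #|A|)%N by apply: leq_ltn_trans ltkA.
have [i Ai imin] := @Order.TotalTheory.arg_minP _ _ _ i0 (mem A) (cost A) Ai0.
have [|B HB] := IH (A :\ i)%SET.
  by move: leAN; rewrite (cardsD1 i) (Ai : i \in A).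
by exists B; apply: (@elimination_step _ _ _ _ _ _ i).
Qed.

(* Main.v *)
Require Import Defs.
From mathcomp Require Import all_boot all_order all_algebra.
From mathcomp Require Import complex.
From mathcomp Require Import reals.

Set Implicit Arguments.
Unset Strict Implicit.
Unset Printing Implicit Defensive.

Import Order.TTheory GRing.Theory Num.Theory.

Local Open Scope ring_scope.
Local Open Scope complex_scope.
Local Open Scope sesquilinear_scope.

(** With S the support of xk and s = sigma_min Phi, both algorithms preserve
    the invariant that S is contained in the active set A. By Pythagoras,
    s |x^(A) - xk| <= |Phi (x^(A) - xk)| <= |r_k|, so LACE sees coefficients
    above min |xk| / 2 on S and below it off S. Backward Regression pays at most
    |r_k| for deleting an index outside S, but deleting i in S yields z with
    z_i = 0 and residual >= |Phi (xk - z)| - |r_k| >= s |xk_i| - |r_k| > |r_k|.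
    At the end |A| <= k, and optimality of xk together with Pythagoras forces
    x^(A) = xk. *)

(** * Euclidean geometry of complex columns *)

Lemma normc_ge0 (R : realType) (z : R[i]) : 0 <= Normc.normc z.
Proof. by case: z => a b; exact: sqrtr_ge0. Qed.

Section EuclideanNorm.
Variables (R : realType) (n : nat).
Implicit Types (u v : 'cV[R[i]]_n).

Lemma norm2_ge0 v : 0 <= norm2 v.
Proof. exact: sqrtr_ge0. Qed.

Lemma sqr_norm2 v : norm2 v ^+ 2 = \sum_(i < n) Normc.normc (v i 0) ^+ 2.
Proof. by rewrite sqr_sqrtr// sumr_ge0// => i _; rewrite sqr_ge0. Qed.

Lemma conjCMnormc (z : R[i]) : z^* * z = (Normc.normc z ^+ 2)%:C.
Proof. by rewrite mulrC -normCK rmorphXn. Qed.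

Lemma sqr_norm2C v : (norm2 v ^+ 2)%:C = (v^t* *m v) 0 0.
Proof.
rewrite sqr_norm2 rmorph_sum mxE; apply: eq_bigr => i _.
by rewrite !mxE conjCMnormc.
Qed.

(** Bridge to the Hermitian form [dotmx], which acts on rows (hence the transposes); its triangle
    inequality then carries over to [norm2]. *)
Lemma norm2C v : (norm2 v)%:C = sqrtC (dotmx v^T v^T).
Proof.
rewrite dotmxE.
suff -> : (v^T *m v^T^t*) 0 0 = (norm2 v ^+ 2)%:C.
  by rewrite rmorphXn sqrCK// lecR norm2_ge0.
rewrite sqr_norm2C !mxE; apply: eq_bigr => i _.
by rewrite !mxE mulrC.
Qed.

Lemma norm2_triangle u v : norm2 (u + v) <= norm2 u + norm2 v.
Proof.
rewrite -lecR rmorphD /= !norm2C linearD.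
by case: (triangle_lerif (@dotmx R[i] n) u^T v^T).
Qed.

Lemma norm2_coord v i : Normc.normc (v i 0) <= norm2 v.
Proof.
rewrite -ler_sqr ?nnegrE ?norm2_ge0 ?normc_ge0// sqr_norm2 (bigD1 i)//= lerDl.
by rewrite sumr_ge0// => j _; rewrite sqr_ge0.
Qed.

Lemma norm2_eq0 v : norm2 v = 0 -> v = 0.
Proof.
move=> v0; apply/matrixP => i j; rewrite ord1 mxE.
apply: Normc.eq0_normc; apply/eqP; rewrite eq_le.
by rewrite -{1}v0 norm2_coord normc_ge0.
Qed.

Lemma norm2N v : norm2 (- v) = norm2 v.
Proof.
by congr Num.sqrt; apply: eq_bigr => i _; rewrite mxE normcN.
Qed.

Lemma norm2_pythagoras u v : u^t* *m v = 0 ->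
  norm2 (u + v) ^+ 2 = norm2 u ^+ 2 + norm2 v ^+ 2.
Proof.
move=> uv; have vu : v^t* *m u = 0.
  by rewrite -[u]trmxCK -trmxC_mul uv trmx0 map_mx0.
apply: complexI; rewrite rmorphD /= !sqr_norm2C.
rewrite [(u + v)^T]linearD map_mxD mulmxDl !mulmxDr uv vu addr0 add0r.
by rewrite mxE.
Qed.

End EuclideanNorm.

(** * Lower bound on [Phi *m v] from the spectral theorem *)

Section SmallestSingularValue.
Variables (R : realType) (n m : nat) (Phi : 'M[R[i]]_(n, m)).
Let G := Phi^t* *m Phi.
Let P := spectralmx G.
Let lambda i := complex.Re (spectral_diag G 0 i).

(** The Gram matrix is normal, so [G] is [P^t* D P] with [P] unitary and [D] diagonal, and the
    squared norm v* G v becomes (P v)* D (P v). *)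
Lemma sqr_norm2_spectral v :
  norm2 (Phi *m v) ^+ 2 = \sum_i lambda i * Normc.normc ((P *m v) i 0) ^+ 2.
Proof.
have /orthomx_spectralP GE : G \is normalmx.
  by apply/normalmxP; rewrite /G trmxC_mul trmxCK.
(* Taking real parts of the complex identity avoids proving first that the eigenvalues are real. *)
have -> : norm2 (Phi *m v) ^+ 2 = complex.Re ((norm2 (Phi *m v) ^+ 2)%:C) by [].
rewrite sqr_norm2C trmxC_mul -mulmxA [Phi^t* *m _]mulmxA -/G GE -/P.
rewrite invmx_unitary ?spectral_unitarymx// -!mulmxA mulmxA -trmxC_mul.
rewrite mxE raddf_sum; apply: eq_bigr => i _.
rewrite mul_diag_mx !mxE mulrCA conjCMnormc /= /lambda.
by case: (spectral_diag G 0 i) => a b /=; rewrite mulr0 subr0.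
Qed.

(** At the i-th eigenvector [P^t* *m delta_mx i 0] the spectral sum collapses to [lambda i], which
    is thus a squared norm. *)
Lemma spectral_eigenvalue_ge0 i : 0 <= lambda i.
Proof.
have := sqr_norm2_spectral (P^t* *m delta_mx i 0).
rewrite [P *m _]mulmxA; have /unitarymxP -> := spectral_unitarymx G.
rewrite mul1mx (bigD1 i)//= big1 => [|j ji]; last first.
  by rewrite mxE (negPf ji) Normc.normc0 expr0n mulr0.
by rewrite mxE !eqxx Normc.normc1 expr1n mulr1 addr0 => <-; rewrite sqr_ge0.
Qed.

Lemma norm2_spectralmx v : norm2 (P *m v) = norm2 v.
Proof.
apply: (pexpIrn (n := 2)) => //; rewrite ?nnegrE ?norm2_ge0//.
apply: complexI; rewrite !sqr_norm2C trmxC_mul -mulmxA [P^t* *m _]mulmxA.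
by rewrite -invmx_unitary ?spectral_unitarymx// mulVmx ?spectral_unit ?mul1mx.
Qed.

Hypothesis rankPhi : \rank Phi = m.

(** Full column rank forces [m <= n], so the truncation to [minn n m] entries drops nothing. *)
Lemma singular_values_full :
  singular_values Phi =
  sort (fun a b : R => b <= a) [seq Num.sqrt (lambda i) | i <- enum 'I_m].
Proof.
rewrite /singular_values (minn_idPr _); last by rewrite -rankPhi rank_leq_row.
by rewrite take_oversize// size_sort size_map size_enum_ord.
Qed.

Lemma sigma_min_ge0 : 0 <= sigma_min Phi.
Proof.
rewrite /sigma_min singular_values_full.
set s := sort _ _; have : {in s, forall a, 0 <= a}.
  by move=> a; rewrite mem_sort => /mapP[i _ ->]; exact: sqrtr_ge0.
(* For [m = 0] the list is empty and [last] returns its default 0. *)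
by case: s => //= a s; apply; exact: mem_last.
Qed.

Lemma sigma_min_le i : sigma_min Phi <= Num.sqrt (lambda i).
Proof.
rewrite /sigma_min singular_values_full; set s := sort _ _.
have ls : Num.sqrt (lambda i) \in s.
  by rewrite mem_sort; apply/mapP; exists i; rewrite ?mem_enum.
have s_gt0 : (0 < size s)%N by case: (s) ls.
have ss : sorted (fun a b : R => b <= a) s.
  by apply: sort_sorted => a b; exact: le_total.
(* Both sides become entries of the decreasing list, so comparing positions suffices. *)
rewrite -(nth_index 0 ls) -nth_last.
apply: (sorted_leq_nth _ _ _ ss) => //.
- by move=> a b c ba ac; exact: le_trans ac ba.
- by rewrite inE index_mem.
- by rewrite inE prednK.
- by rewrite -ltnS prednK// index_mem.
Qed.

(** In eigenvector coordinates every weight [lambda i] is at least the square of [sigma_min Phi],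
    and the unitary change of coordinates preserves the norm. *)
Lemma sigma_min_norm2 v : sigma_min Phi * norm2 v <= norm2 (Phi *m v).
Proof.
rewrite -ler_sqr ?nnegrE ?mulr_ge0 ?sigma_min_ge0 ?norm2_ge0//.
rewrite exprMn -norm2_spectralmx sqr_norm2_spectral sqr_norm2 mulr_sumr.
apply: ler_sum => i _; rewrite ler_wpM2r ?sqr_ge0//.
rewrite -(sqr_sqrtr (spectral_eigenvalue_ge0 i)).
by rewrite ler_sqr ?nnegrE ?sqrtr_ge0 ?sigma_min_ge0 ?sigma_min_le.
Qed.

End SmallestSingularValue.

(** * Least squares as orthogonal projection onto the active columns *)

Section LeastSquares.
Variables (R : realType) (n m : nat) (Phi : 'M[R[i]]_(n, m)) (y : 'cV[R[i]]_n).
Implicit Types (A : {set 'I_m}) (v : 'cV[R[i]]_m).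

Lemma supp_out A v i : supp v \subset A -> i \notin A -> v i 0 = 0.
Proof.
move=> sA iA; apply: contraNeq iA => vi.
by apply: (subsetP sA); rewrite inE.
Qed.

Lemma mulmx_supp A v : supp v \subset A ->
  Phi *m v = subcols Phi A *m (\col_j v (enum_val j) 0).
Proof.
move=> sA; apply/matrixP => i j; rewrite ord1 !mxE.
rewrite (bigID (mem A)) /= [X in _ + X]big1 => [|l lA]; last first.
  by rewrite (supp_out sA lA) mulr0.
by rewrite addr0 big_enum_val; apply: eq_bigr => l _; rewrite !mxE.
Qed.

Lemma supp_ls_coef A : supp (ls_coef Phi y A) \subset A.
Proof.
apply/subsetP => i; rewrite inE mxE.
by case: pickP => [j /eqP <-|_]; rewrite ?eqxx// enum_valP.
Qed.

Lemma mulmx_ls_coef A :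
  Phi *m ls_coef Phi y A = subcols Phi A *m (pinv (subcols Phi A) *m y).
Proof.
rewrite (mulmx_supp (supp_ls_coef A)); congr (_ *m _).
apply/matrixP => j l; rewrite ord1 !mxE.
by case: pickP => [j' /eqP/enum_val_inj -> |/(_ j)]; rewrite ?mxE ?eqxx.
Qed.

Lemma ls_residualE A : ls_residual Phi y A = y - Phi *m ls_coef Phi y A.
Proof. by rewrite mulmx_ls_coef /ls_residual mulmxBl mul1mx mulmxA. Qed.

Lemma ls_residual_orthogonal A v : supp v \subset A ->
  (Phi *m v)^t* *m ls_residual Phi y A = 0.
Proof.
move=> sA; rewrite (mulmx_supp sA) trmxC_mul /ls_residual.
set M := subcols Phi A; have [MXM _ MXh _] := pinvP M.
rewrite -mulmxA [M^t* *m _]mulmxA mulmxBr mulmx1.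
(* With X the pseudoinverse, M* M X = M* (M X)* = (M X M)* = M*. *)
by rewrite -MXh -trmxC_mul MXM subrr mul0mx mulmx0.
Qed.

(** [y - Phi *m v] splits into [Phi *m (ls_coef Phi y A - v)], in the span of the columns in [A],
    and the residual orthogonal to that span. *)
Lemma ls_pythagoras A v : supp v \subset A ->
  norm2 (y - Phi *m v) ^+ 2 =
  norm2 (Phi *m (ls_coef Phi y A - v)) ^+ 2 + norm2 (ls_residual Phi y A) ^+ 2.
Proof.
move=> sA; rewrite -norm2_pythagoras.
  by rewrite ls_residualE mulmxBr [in RHS]addrC addrA subrK.
apply: ls_residual_orthogonal; apply/subsetP => i; apply: contraTT => iA.
have zi : ls_coef Phi y A i 0 = 0 := supp_out (supp_ls_coef A) iA.
by rewrite inE mxE zi mxE (supp_out sA iA) subrr eqxx.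
Qed.

Lemma norm2_ls_residual_le A v : supp v \subset A ->
  norm2 (ls_residual Phi y A) <= norm2 (y - Phi *m v).
Proof.
move=> sA; rewrite -ler_sqr ?nnegrE ?norm2_ge0// (ls_pythagoras sA).
by rewrite lerDr sqr_ge0.
Qed.

Lemma norm2_ls_coefB_le A v : supp v \subset A ->
  norm2 (Phi *m (ls_coef Phi y A - v)) <= norm2 (y - Phi *m v).
Proof.
move=> sA; rewrite -ler_sqr ?nnegrE ?norm2_ge0// (ls_pythagoras sA).
by rewrite lerDl sqr_ge0.
Qed.

End LeastSquares.

(** * Invariance of the support under elimination, and recovery *)

Lemma min_abs_supp_le (R : realType) (m : nat) (x : 'cV[R[i]]_m) i :
  i \in supp x -> min_abs_supp x <= Normc.normc (x i 0).
Proof.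
move=> ix; apply: ge_inf; last by exists i.
(* The infimum bounds its set from below only once the set is known to have a lower bound; 0
   serves. *)
by exists 0 => _ [j _ <-]; exact: normc_ge0.
Qed.

(** Common to both algorithms: it remains to show that no cost-minimizing index lies in [S] while
    more than [k] indices are active. *)
Lemma elimination_invariant (R : realType) (m k : nat)
    (cost : {set 'I_m} -> 'I_m -> R) (S A B : {set 'I_m}) :
  (forall (C : {set 'I_m}) i, S \subset C -> (k < #|C|)%N -> i \in C ->
    (forall j, j \in C -> cost C i <= cost C j) -> i \notin S) ->
  elimination cost k A B -> S \subset A -> S \subset B /\ (#|B| <= k)%N.
Proof.
move=> safe; elim=> // C D i kC iC imin _ IH SC; apply: IH.
by rewrite subsetD1 SC; exact: safe kC iC imin.
Qed.

Section Recovery.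
Variables (R : realType) (n m k : nat).
Variables (Phi : 'M[R[i]]_(n, m)) (y : 'cV[R[i]]_n) (xk : 'cV[R[i]]_m).
Hypothesis rankPhi : \rank Phi = m.
Hypothesis xk_sol : subset_selection_solution Phi y k xk.
Hypothesis gap : sigma_min Phi / 2 * min_abs_supp xk > norm2 (y - Phi *m xk).

Lemma gap_sigma_min_gt0 : 0 < sigma_min Phi.
Proof.
rewrite lt_neqAle sigma_min_ge0// andbT; apply: contraTneq gap => <-.
by rewrite !mul0r -leNgt norm2_ge0.
Qed.

(** The form of the gap that both safety arguments contradict. *)
Lemma gap_coef i : i \in supp xk ->
  norm2 (y - Phi *m xk) *+ 2 < sigma_min Phi * Normc.normc (xk i 0).
Proof.
move=> iS; rewrite -mulr_natr -ltr_pdivlMr//.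
apply: lt_le_trans gap _; rewrite mulrAC ler_pM2r ?invr_gt0//.
by rewrite ler_pM2l ?gap_sigma_min_gt0 ?min_abs_supp_le.
Qed.

(** Supplies the competitor off the support against which the deleted index is compared. *)
Lemma exists_spare (C : {set 'I_m}) : supp xk \subset C -> (k < #|C|)%N ->
  exists2 j, j \in C & j \notin supp xk.
Proof.
move=> SC kC; have /properP[_ [j]] : supp xk \proper C; last by exists j.
by rewrite properEcard SC (leq_ltn_trans _ kC)//; case: xk_sol.
Qed.

Lemma ls_coef_recovers (A : {set 'I_m}) :
  supp xk \subset A -> (#|A| <= k)%N -> ls_coef Phi y A = xk.
Proof.
move=> SA Ak; apply/eqP; rewrite -subr_eq0; apply/eqP/norm2_eq0.
have opt : norm2 (y - Phi *m xk) <= norm2 (ls_residual Phi y A).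
  rewrite ls_residualE; apply: xk_sol.2; apply: leq_trans Ak.
  exact/subset_leq_card/supp_ls_coef.
have := ls_pythagoras Phi y SA.
(* Pythagoras turns optimality into a^2 + b^2 <= b^2 with a the norm of
   [Phi *m (ls_coef Phi y A - xk)], so a vanishes. *)
move: opt; rewrite -ler_sqr ?nnegrE ?norm2_ge0// => /[swap] ->.
rewrite gerDr => Phi0; apply/eqP; rewrite eq_le norm2_ge0 andbT.
rewrite -(pmulr_rle0 _ gap_sigma_min_gt0).
apply: le_trans (sigma_min_norm2 rankPhi _) _.
by rewrite -(@ler_pXn2r _ 2) ?nnegrE ?norm2_ge0// expr0n.
Qed.

Lemma backward_regression_safe (C : {set 'I_m}) i :
  supp xk \subset C -> (k < #|C|)%N ->
  (forall j, j \in C -> norm2 (ls_residual Phi y (C :\ i)%SET)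
                        <= norm2 (ls_residual Phi y (C :\ j)%SET)) ->
  i \notin supp xk.
Proof.
move=> SC kC imin; have [j jC jS] := exists_spare SC kC.
apply/negP => iS; have := gap_coef iS; apply/negP; rewrite -leNgt.
set z := ls_coef Phi y (C :\ i)%SET.
have zi : z i 0 = 0 by rewrite (supp_out (supp_ls_coef _ _ _))// !inE eqxx.
(* The spare [j] is off the support, so [xk] is still admissible on [C :\ j] and bounds the cost of
   deleting [j], hence that of deleting [i]. *)
have le_r : norm2 (y - Phi *m z) <= norm2 (y - Phi *m xk).
  rewrite -ls_residualE; apply: le_trans (imin j jC) _.
  by apply: norm2_ls_residual_le; rewrite subsetD1 SC.
have -> : xk i 0 = (xk - z) i 0 by rewrite mxE [(- z) _ _]mxE zi subr0.
apply: (@le_trans _ _ (norm2 (Phi *m (xk - z)))).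
  apply: le_trans (sigma_min_norm2 rankPhi _).
  by rewrite ler_wpM2l ?sigma_min_ge0 ?norm2_coord.
have -> : Phi *m (xk - z) = (y - Phi *m z) + - (y - Phi *m xk).
  by rewrite mulmxBr opprB [in RHS]addrC addrA subrK.
by apply: le_trans (norm2_triangle _ _) _; rewrite norm2N mulr2n lerD2r.
Qed.

Lemma lace_safe (C : {set 'I_m}) i :
  supp xk \subset C -> (k < #|C|)%N ->
  (forall j, j \in C -> Normc.normc (ls_coef Phi y C i 0)
                        <= Normc.normc (ls_coef Phi y C j 0)) ->
  i \notin supp xk.
Proof.
move=> SC kC imin; have [j jC jS] := exists_spare SC kC.
apply/negP => iS; have := gap_coef iS; apply/negP; rewrite -leNgt.
move: (imin j jC) (norm2_ls_coefB_le Phi y SC).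
set z := ls_coef Phi y C => le_ij le_r.
(* It suffices to bound the modulus of [xk i 0] by twice [norm2 (z - xk)]: once for the error at
   [i], once for [z i 0], itself at most the error at [j], where [xk] vanishes. *)
apply: (@le_trans _ _ (sigma_min Phi * (norm2 (z - xk) *+ 2))); last first.
  rewrite mulrnAr lerMn2r; apply: le_trans le_r.
  exact: sigma_min_norm2.
rewrite ler_wpM2l ?sigma_min_ge0//.
have -> : xk i 0 = z i 0 + - (z - xk) i 0.
  by rewrite [(z - xk) i 0]mxE [(- xk) _ _]mxE opprB addrC subrK.
apply: le_trans (le_normcD _ _) _; rewrite normcN mulr2n lerD ?norm2_coord//.
apply: le_trans le_ij _.
have -> : z j 0 = (z - xk) j 0.
  by rewrite [(z - xk) j 0]mxE [(- xk) _ _]mxE (supp_out (subxx _) jS) subr0.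
exact: norm2_coord.
Qed.

End Recovery.

Theorem corollary3p2 (R : realType) (n m k : nat)
    (Phi : 'M[R[i]]_(n, m)) (y : 'cV[R[i]]_n) (xk : 'cV[R[i]]_m)
    (full_col_rank : \rank Phi = m)
    (k_ge1 : (1 <= k)%N) (k_le_m : (k <= m)%N)
    (xk_neq0 : xk != 0)
    (xk_sol : subset_selection_solution Phi y k xk)
    (gap : sigma_min Phi / 2 * min_abs_supp xk > norm2 (y - Phi *m xk)) :
  (forall A : {set 'I_m}, backward_regression Phi y k A ->
     ls_coef Phi y A = xk) /\
  (forall A : {set 'I_m}, lace Phi y k A ->
     ls_coef Phi y A = xk).
Proof.
split=> A elimA.
- have [] := elimination_invariant _ elimA (subsetT (supp xk)).
    by move=> C i SC kC _ imin; exact: backward_regression_safe kC imin.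
  exact: ls_coef_recovers.
- have [] := elimination_invariant _ elimA (subsetT (supp xk)).
    by move=> C i SC kC _ imin; exact: lace_safe kC imin.
  exact: ls_coef_recovers.
Qed.
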